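(* Web functions of linear $3$-webs can be chosen as solutions of the Euler equation. That is, if a $3$-web given by the foliations $\{x=\mathrm{const}\}$, $\{y=\mathrm{const}\}$, $\{f(x,y)=\mathrm{const}\}$ is linear, then (locally) it admits a web function $w(x,y)$ satisfying $$\partial_x w-w\,\partial_y w=0 .$$
   Context: Here $(x,y)$ are coordinates on a domain of $\mathbb{R}^2$. A $3$-web given by a web function $f$ (smooth, $f_x\ne 0$, $f_y\neq 0$) consists of the three foliations $\{x=\mathrm{const}\}$, $\{y=\mathrm{const}\}$, $\{f=\mathrm{const}\}$. The web function is defined only up to a gauge transformation $f\mapsto F(f)$, which does not change the web. The web is linear if all leaves of the three foliations are straight lines in the $(x,y)$-plane. The Euler equation (of gas dynamics) is $\partial_x w-w\,\partial_y w=0$.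
   Formalization: For parallel webs such as f = x + y no web function with nonzero partials solves the Euler equation; so w = F(f) smooth and solving it is proved near every point, with w_x, w_y nonzero asserted only where the slope of the leaves f = const has nonzero differential. *)

(* Defs.v *)
From Stdlib Require Import Reals.
From Coquelicot Require Import Coquelicot.
Open Scope R_scope.

(* Functions on the plane are curried, subsets of the plane are predicates on
   [R * R]; this is what Coquelicot's [ex_diff_n] and [open] expect. *)

Definition dx (f : R -> R -> R) (x y : R) : R := Derive (fun u => f u y) x.
Definition dy (f : R -> R -> R) (x y : R) : R := Derive (fun v => f x v) y.

(* [ex_diff_n f n x y]: all partial derivatives of order at most n exist and
   are continuous at (x, y). Used on open sets only. *)
Definition smooth_on (D : R * R -> Prop) (f : R -> R -> R) : Prop :=
  forall x y, D (x, y) -> forall n, ex_diff_n f n x y.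

(* The path is defined on all of R but constrained only on [0, 1]; a path on
   [0, 1] extends continuously by constants. *)
Definition joined_in (A : R * R -> Prop) (p q : R * R) : Prop :=
  exists gamma : R -> R * R,
    (forall t, continuous gamma t) /\
    (forall t, 0 <= t <= 1 -> A (gamma t)) /\
    gamma 0 = p /\ gamma 1 = q.

Definition plane_domain (D : R * R -> Prop) : Prop :=
  open D /\ forall p q, D p -> D q -> joined_in D p q.

Definition web_function (D : R * R -> Prop) (f : R -> R -> R) : Prop :=
  smooth_on D f /\
  forall x y, D (x, y) -> dx f x y <> 0 /\ dy f x y <> 0.

Definition level_set (D : R * R -> Prop) (g : R -> R -> R) (c : R)
  (q : R * R) : Prop := D q /\ g (fst q) (snd q) = c.

(* Leaves are the connected components of the level sets, not the level sets
   themselves. *)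
Definition leaf (D : R * R -> Prop) (g : R -> R -> R) (p q : R * R) : Prop :=
  joined_in (level_set D g (g (fst p) (snd p))) p q.

Definition straight_line (L : R * R -> Prop) : Prop :=
  exists a b c : R, (a <> 0 \/ b <> 0) /\
    forall q, L q <-> a * fst q + b * snd q = c.

(* Inside a domain a leaf is only a piece of a line, hence the inclusion. *)
Definition linear_foliation (D : R * R -> Prop) (g : R -> R -> R) : Prop :=
  forall p, D p ->
    exists L, straight_line L /\ forall q, leaf D g p q -> L q.

Definition linear_web (D : R * R -> Prop) (f : R -> R -> R) : Prop :=
  linear_foliation D (fun x _ => x) /\
  linear_foliation D (fun _ y => y) /\
  linear_foliation D f.

Definition solves_euler (U : R * R -> Prop) (w : R -> R -> R) : Prop :=
  forall x y, U (x, y) -> dx w x y - w x y * dy w x y = 0.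

(* [w] arises from [f] by a substitution f |-> F(f) on [U]. No condition
   F' <> 0 is imposed here: where [w] is itself a web function it follows from
   dx w = F'(f) * dx f. *)
Definition function_of (U : R * R -> Prop) (f w : R -> R -> R) : Prop :=
  exists F : R -> R,
    forall x y, U (x, y) ->
      (forall n, ex_derive_n F n (f x y)) /\ w x y = F (f x y).

Definition leaf_slope (f : R -> R -> R) (x y : R) : R :=
  - dx f x y / dy f x y.

(* The slope of the leaves {f = const} has nonzero differential, i.e. nearby
   leaves are not parallel to first order. If w = F(f) solves the Euler equation
   near a point where F' <> 0, then w = dx f / dy f there, so w can be a web
   function (dx w <> 0, dy w <> 0) only where this holds. For f = x + y it holds
   nowhere: dx w - w * dy w = F' * (1 - F), so F' <> 0 on an interval would force
   F = 1 there, a contradiction. *)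
Definition leaves_turn (f : R -> R -> R) (q : R * R) : Prop :=
  dx (leaf_slope f) (fst q) (snd q) <> 0 \/
  dy (leaf_slope f) (fst q) (snd q) <> 0.

(* Main.v *)
Require Import Defs.
From Stdlib Require Import Reals Lra Lia ClassicalEpsilon.
From Coquelicot Require Import Coquelicot.
Open Scope R_scope.

(** The gauge is [w = dx f / dy f], minus the slope of the leaves of [f].

    Near the given point, the level sets of [f] are graphs of continuous
    functions [Y(., c)] over one and the same interval of the [x]-axis, because
    [dy f] does not vanish ([level_chart_exists]).  Such a graph is connected,
    so it lies in one leaf and hence in a line; the line is not vertical, since
    it contains points over a whole interval ([level_curve_straight]).
    Therefore [Y(x, c) = k + m x], and differentiating [f (x, k + m x) = c]
    gives [w = - m] along the entire graph ([slope_on_level_curve]): [w] is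
    constant on the level sets of [f], in other words [w = F(f)] with
    [F(c) = w (x0, Y(x0, c))].

    The function [F] is smooth because every [G (x0, Y(x0, c))] with [G] smooth
    has, by the inverse function theorem, a derivative in [c] of the same form,
    with [dy G / dy f] in place of [G] ([is_derive_transversal]); this can be
    iterated.

    Euler's equation is then the chain rule:
    [dx w - w dy w = F'(f) (dx f - w dy f) = 0], the bracket being zero by the
    choice of [w] ([function_of_euler]).  Since [w] is nowhere zero, Euler's
    equation makes [dx w] and [dy w] vanish together, so neither vanishes where
    the slope [- w] has nonzero differential ([euler_web_function]). *)

(** * Neighbourhoods and sections *)

Lemma open_locally_2d (D : R * R -> Prop) (x y : R) :
  open D -> D (x, y) -> locally_2d (fun u v => D (u, v)) x y.
Proof.
  intros oD Dxy. apply locally_2d_locally.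
  refine (filter_imp _ _ _ (oD _ Dxy)). now intros [u v].
Qed.

Lemma continuity_2d_pt_section_l (f : R -> R -> R) (x y : R) :
  continuity_2d_pt f x y -> continuity_pt (fun u => f u y) x.
Proof.
  intros cf. apply continuity_pt_filterlim, filterlim_locally; intros e.
  destruct (cf e) as [d Hd]. exists d; intros u Hu. apply Hd; auto.
  rewrite Rminus_diag, Rabs_R0. apply cond_pos.
Qed.

Lemma continuity_2d_pt_section_r (f : R -> R -> R) (x y : R) :
  continuity_2d_pt f x y -> continuity_pt (fun v => f x v) y.
Proof.
  intros cf. apply continuity_pt_filterlim, filterlim_locally; intros e.
  destruct (cf e) as [d Hd]. exists d; intros v Hv. apply Hd; auto.
  rewrite Rminus_diag, Rabs_R0. apply cond_pos.
Qed.

Lemma locally_abs_lt (a r c : R) :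
  Rabs (c - a) < r -> locally c (fun s => Rabs (s - a) < r).
Proof.
  intros H. assert (0 < r - Rabs (c - a)) as p by lra.
  exists (mkposreal _ p). intros s Hs. change (Rabs (s - c) < r - Rabs (c - a)) in Hs.
  replace (s - a) with ((s - c) + (c - a)) by ring.
  eapply Rle_lt_trans; [apply Rabs_triang|]. lra.
Qed.

(** * Smooth functions on an open set of the plane *)

(** Closure properties are proved one order of differentiability at a time,
    by induction on [n]: smoothness alone would give no induction to run on. *)
Definition class_C (n : nat) (D : R * R -> Prop) (f : R -> R -> R) : Prop :=
  forall x y, D (x, y) -> ex_diff_n f n x y.

Lemma ex_diff_n_continuity_2d_pt (f : R -> R -> R) (n : nat) (x y : R) :
  ex_diff_n f n x y -> continuity_2d_pt f x y.
Proof. now destruct n; intros H; apply H. Qed.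

Lemma class_C_pred (n : nat) (D : R * R -> Prop) (f : R -> R -> R) :
  class_C (S n) D f -> class_C n D f.
Proof.
  intros Cf x y Dxy. apply ex_diff_n_m with (S n); [lia | auto].
Qed.

Lemma class_C_dx (n : nat) (D : R * R -> Prop) (f : R -> R -> R) :
  class_C (S n) D f -> class_C n D (dx f).
Proof. intros Cf x y Dxy. apply (Cf x y Dxy). Qed.

Lemma class_C_dy (n : nat) (D : R * R -> Prop) (f : R -> R -> R) :
  class_C (S n) D f -> class_C n D (dy f).
Proof. intros Cf x y Dxy. apply (Cf x y Dxy). Qed.

Lemma class_C_is_derive_x (n : nat) (D : R * R -> Prop) (f : R -> R -> R)
    (x y : R) :
  class_C (S n) D f -> D (x, y) -> is_derive (fun u => f u y) x (dx f x y).
Proof. intros Cf Dxy. apply Derive_correct, (Cf x y Dxy). Qed.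

Lemma class_C_is_derive_y (n : nat) (D : R * R -> Prop) (f : R -> R -> R)
    (x y : R) :
  class_C (S n) D f -> D (x, y) -> is_derive (fun v => f x v) y (dy f x y).
Proof. intros Cf Dxy. apply Derive_correct, (Cf x y Dxy). Qed.

(** This is how membership in [class_C] is shown below: the partial derivatives
    are only known to agree with formulas [fx], [fy] on [D], and openness of [D]
    is what allows the formulas to be differentiated in their place. *)
Lemma class_C_intro (n : nat) (D : R * R -> Prop) (f fx fy : R -> R -> R) :
  open D ->
  (forall x y, D (x, y) -> continuity_2d_pt f x y) ->
  (forall x y, D (x, y) -> is_derive (fun u => f u y) x (fx x y)) ->
  (forall x y, D (x, y) -> is_derive (fun v => f x v) y (fy x y)) ->
  class_C n D fx -> class_C n D fy -> class_C (S n) D f.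
Proof.
  intros oD cf dfx dfy Cx Cy x y Dxy.
  pose proof (open_locally_2d _ _ _ oD Dxy) as lD.
  split; [auto|]. split; [eexists; now apply dfx|].
  split; [eexists; now apply dfy|].
  split.
  - apply ex_diff_n_ext_loc with fx; [|auto].
    refine (locally_2d_impl _ _ _ _ _ lD). apply locally_2d_forall; intros u v Duv.
    symmetry. now apply is_derive_unique, dfx.
  - apply ex_diff_n_ext_loc with fy; [|auto].
    refine (locally_2d_impl _ _ _ _ _ lD). apply locally_2d_forall; intros u v Duv.
    symmetry. now apply is_derive_unique, dfy.
Qed.

(** The factor [k] makes sums, differences and opposites instances of a single
    induction. *)
Lemma class_C_axpy (n : nat) (D : R * R -> Prop) (k : R) (f g : R -> R -> R) :
  open D -> class_C n D f -> class_C n D g ->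
  class_C n D (fun x y => f x y + k * g x y).
Proof.
  intros oD. revert f g.
  assert (cont : forall f g x y, continuity_2d_pt f x y ->
    continuity_2d_pt g x y ->
    continuity_2d_pt (fun x y => f x y + k * g x y) x y).
  { intros f g x y cf cg. apply continuity_2d_pt_plus; auto.
    apply continuity_2d_pt_mult; auto. apply continuity_2d_pt_const. }
  induction n as [|n IH]; intros f g Cf Cg.
  - intros x y Dxy. split; [|exact I]. apply cont; [apply Cf | apply Cg]; auto.
  - apply class_C_intro with (fun x y => dx f x y + k * dx g x y)
      (fun x y => dy f x y + k * dy g x y); auto using class_C_dx, class_C_dy.
    + intros x y Dxy. apply cont; eapply ex_diff_n_continuity_2d_pt; eauto.
    + intros x y Dxy. apply @is_derive_plus.
      * exact (class_C_is_derive_x _ _ _ _ _ Cf Dxy).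
      * apply is_derive_scal. exact (class_C_is_derive_x _ _ _ _ _ Cg Dxy).
    + intros x y Dxy. apply @is_derive_plus.
      * exact (class_C_is_derive_y _ _ _ _ _ Cf Dxy).
      * apply is_derive_scal. exact (class_C_is_derive_y _ _ _ _ _ Cg Dxy).
Qed.

(** The factor [1] gives the derivative the shape [class_C_axpy] handles; the
    factor [-1] in [is_derive_quotient] is there for the same reason. *)
Lemma is_derive_mult_R (f g : R -> R) (x df dg : R) :
  is_derive f x df -> is_derive g x dg ->
  is_derive (fun t => f t * g t) x (df * g x + 1 * (f x * dg)).
Proof.
  intros Hf Hg.
  replace (df * g x + 1 * (f x * dg)) with (plus (mult df (g x)) (mult (f x) dg))
    by (unfold plus, mult; simpl; ring).
  apply @is_derive_mult; auto. exact Rmult_comm.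
Qed.

Lemma class_C_mult (n : nat) (D : R * R -> Prop) (f g : R -> R -> R) :
  open D -> class_C n D f -> class_C n D g ->
  class_C n D (fun x y => f x y * g x y).
Proof.
  intros oD. revert f g. induction n as [|n IH]; intros f g Cf Cg.
  - intros x y Dxy. split; [|exact I].
    apply continuity_2d_pt_mult; [apply Cf | apply Cg]; auto.
  - apply class_C_intro with
      (fun x y => dx f x y * g x y + 1 * (f x y * dx g x y))
      (fun x y => dy f x y * g x y + 1 * (f x y * dy g x y));
      auto using class_C_axpy, class_C_dx, class_C_dy, class_C_pred.
    + intros x y Dxy.
      apply continuity_2d_pt_mult; eapply ex_diff_n_continuity_2d_pt; eauto.
    + intros x y Dxy. apply (is_derive_mult_R (fun u => f u y) (fun u => g u y)).
      * exact (class_C_is_derive_x _ _ _ _ _ Cf Dxy).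
      * exact (class_C_is_derive_x _ _ _ _ _ Cg Dxy).
    + intros x y Dxy. apply (is_derive_mult_R (fun v => f x v) (fun v => g x v)).
      * exact (class_C_is_derive_y _ _ _ _ _ Cf Dxy).
      * exact (class_C_is_derive_y _ _ _ _ _ Cg Dxy).
Qed.

(** In this form of the quotient rule the derivative is again a quotient by the
    same [g], so that an induction on the order needs no squares. *)
Lemma is_derive_quotient (f g : R -> R) (x df dg : R) :
  is_derive f x df -> is_derive g x dg -> g x <> 0 ->
  is_derive (fun t => f t / g t) x ((df + -1 * (f x / g x * dg)) / g x).
Proof.
  intros Hf Hg g0.
  replace ((df + -1 * (f x / g x * dg)) / g x)
    with ((df * g x - f x * dg) / g x ^ 2) by (now field).
  now apply is_derive_div.
Qed.

Lemma class_C_div (n : nat) (D : R * R -> Prop) (f g : R -> R -> R) :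
  open D -> class_C n D f -> class_C n D g ->
  (forall x y, D (x, y) -> g x y <> 0) ->
  class_C n D (fun x y => f x y / g x y).
Proof.
  intros oD Cf Cg g0. revert f Cf.
  assert (cont : forall f x y, D (x, y) -> continuity_2d_pt f x y ->
    continuity_2d_pt (fun x y => f x y / g x y) x y).
  { intros f x y Dxy cf. apply continuity_2d_pt_mult; auto.
    apply continuity_2d_pt_inv; auto.
    eapply ex_diff_n_continuity_2d_pt; eauto. }
  induction n as [|n IH]; intros f Cf.
  - intros x y Dxy. split; [|exact I]. apply cont; auto. now apply Cf.
  - pose proof (IH (class_C_pred _ _ _ Cg)) as IHn.
    apply class_C_intro with
      (fun x y => (dx f x y + -1 * (f x y / g x y * dx g x y)) / g x y)
      (fun x y => (dy f x y + -1 * (f x y / g x y * dy g x y)) / g x y);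
      auto 7 using class_C_axpy, class_C_mult, class_C_dx, class_C_dy, class_C_pred.
    + intros x y Dxy. apply cont; auto. eapply ex_diff_n_continuity_2d_pt; eauto.
    + intros x y Dxy.
      apply (is_derive_quotient (fun u => f u y) (fun u => g u y)); auto.
      * exact (class_C_is_derive_x _ _ _ _ _ Cf Dxy).
      * exact (class_C_is_derive_x _ _ _ _ _ Cg Dxy).
    + intros x y Dxy.
      apply (is_derive_quotient (fun v => f x v) (fun v => g x v)); auto.
      * exact (class_C_is_derive_y _ _ _ _ _ Cf Dxy).
      * exact (class_C_is_derive_y _ _ _ _ _ Cg Dxy).
Qed.

Lemma smooth_on_class_C (D : R * R -> Prop) (f : R -> R -> R) (n : nat) :
  smooth_on D f -> class_C n D f.
Proof. intros sf x y Dxy. now apply sf. Qed.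

Lemma smooth_on_dx (D : R * R -> Prop) (f : R -> R -> R) :
  smooth_on D f -> smooth_on D (dx f).
Proof. intros sf x y Dxy n. now apply (sf x y Dxy (S n)). Qed.

Lemma smooth_on_dy (D : R * R -> Prop) (f : R -> R -> R) :
  smooth_on D f -> smooth_on D (dy f).
Proof. intros sf x y Dxy n. now apply (sf x y Dxy (S n)). Qed.

Lemma smooth_on_div (D : R * R -> Prop) (f g : R -> R -> R) :
  open D -> smooth_on D f -> smooth_on D g ->
  (forall x y, D (x, y) -> g x y <> 0) ->
  smooth_on D (fun x y => f x y / g x y).
Proof.
  intros oD sf sg g0 x y Dxy n.
  apply (class_C_div n D f g); auto using smooth_on_class_C.
Qed.

Lemma smooth_on_continuity (D : R * R -> Prop) (f : R -> R -> R) (x y : R) :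
  smooth_on D f -> D (x, y) -> continuity_2d_pt f x y.
Proof. intros sf Dxy. now apply (sf x y Dxy 0%nat). Qed.

Lemma smooth_on_opp (D : R * R -> Prop) (f : R -> R -> R) :
  open D -> smooth_on D f -> smooth_on D (fun x y => - f x y).
Proof.
  intros oD sf x y Dxy n.
  apply ex_diff_n_ext_loc with (fun x y => f x y + -2 * f x y).
  - apply locally_2d_forall; intros; ring.
  - apply (class_C_axpy n D (-2) f f); auto using smooth_on_class_C.
Qed.

Lemma dy_opp (f : R -> R -> R) (x y : R) :
  dy (fun x y => - f x y) x y = - dy f x y.
Proof. apply Derive_opp. Qed.

Lemma smooth_on_is_derive_x (D : R * R -> Prop) (f : R -> R -> R) (x y : R) :
  smooth_on D f -> D (x, y) -> is_derive (fun u => f u y) x (dx f x y).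
Proof.
  intros sf. apply class_C_is_derive_x with 0%nat. now apply smooth_on_class_C.
Qed.

Lemma smooth_on_is_derive_y (D : R * R -> Prop) (f : R -> R -> R) (x y : R) :
  smooth_on D f -> D (x, y) -> is_derive (fun v => f x v) y (dy f x y).
Proof.
  intros sf. apply class_C_is_derive_y with 0%nat. now apply smooth_on_class_C.
Qed.

(** Continuity of the partial derivatives gives total differentiability, which
    the chain rule along a curve requires. *)
Lemma is_derive_along_line (D : R * R -> Prop) (f : R -> R -> R) (k m x : R) :
  open D -> smooth_on D f -> D (x, k + m * x) ->
  is_derive (fun t => f t (k + m * t)) x
    (dx f x (k + m * x) + m * dy f x (k + m * x)).
Proof.
  intros oD sf Dx.
  apply is_derive_Reals.
  replace (dx f x (k + m * x) + m * dy f x (k + m * x)) with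
    (dx f x (k + m * x) * 1 + dy f x (k + m * x) * m) by ring.
  apply derivable_pt_lim_comp_2d with (f2 := fun t => t)
    (f3 := fun t => k + m * t).
  - apply filterdiff_differentiable_pt_lim.
    apply (is_derive_filterdiff f x (k + m * x) (dx f)).
    + refine (filter_imp _ _ _ (oD _ Dx)). intros [u v] Duv.
      now apply (smooth_on_is_derive_x D).
    + now apply (smooth_on_is_derive_y D).
    + apply continuity_2d_pt_filterlim.
      apply (smooth_on_continuity D); auto. now apply smooth_on_dx.
  - apply derivable_pt_lim_id.
  - apply is_derive_Reals. auto_derive; auto; ring.
Qed.

(** * The implicit function theorem *)

(** [Y x c] is the height at abscissa [x] of the level curve [f = c]: the chart
    flattens the level curves near [(x0, y0)] to the horizontals [c = const].
    The bound [delta] on [x] does not depend on [c], so that all level curves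
    met here cross the vertical [x = x0]. *)
Definition level_chart (f : R -> R -> R) (x0 y0 delta eta eps : R)
    (Y : R -> R -> R) : Prop :=
  (forall x c, Rabs (x - x0) < delta -> Rabs (c - f x0 y0) < eps ->
     Rabs (Y x c - y0) < eta /\ f x (Y x c) = c /\ continuity_2d_pt Y x c) /\
  (forall x y, Rabs (x - x0) < delta -> Rabs (y - y0) < eta ->
     Rabs (f x y - f x0 y0) < eps -> Y x (f x y) = y).

Ltac abs_lra :=
  repeat match goal with
  | H : Rabs _ < _ |- _ => apply Rabs_def2 in H; destruct H
  end;
  try (apply Rabs_def1); lra.

(** The intermediate value theorem gives a solution on each vertical, and
    monotonicity its uniqueness.  For continuity at [(x, c)], the strict
    inequalities [f x (y - r) < c < f x (y + r)] at [y = Y x c] persist nearby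
    and trap the nearby solutions between [y - r] and [y + r]. *)
Lemma level_chart_increasing (f : R -> R -> R) (x0 y0 a : R) :
  0 < a ->
  (forall x y, Rabs (x - x0) < a -> Rabs (y - y0) < a ->
     continuity_2d_pt f x y) ->
  (forall x y1 y2, Rabs (x - x0) < a -> Rabs (y1 - y0) < a ->
     Rabs (y2 - y0) < a -> y1 < y2 -> f x y1 < f x y2) ->
  exists delta eta eps Y, 0 < delta <= a /\ 0 < eta <= a /\ 0 < eps /\
    level_chart f x0 y0 delta eta eps Y.
Proof.
  intros a0 cf incr.
  assert (x00 : Rabs (x0 - x0) < a) by (rewrite Rminus_diag, Rabs_R0; auto).
  assert (y00 : Rabs (y0 - y0) < a) by (rewrite Rminus_diag, Rabs_R0; auto).
  set (eta := a / 2).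
  assert (ylo : Rabs (y0 - eta - y0) < a) by (unfold eta; abs_lra).
  assert (yhi : Rabs (y0 + eta - y0) < a) by (unfold eta; abs_lra).
  assert (lo : f x0 (y0 - eta) < f x0 y0) by (apply incr; unfold eta; auto; lra).
  assert (hi : f x0 y0 < f x0 (y0 + eta)) by (apply incr; unfold eta; auto; lra).
  (* Half of the smaller gap: one half absorbs the variation of [f] in [x], the
     other the distance from [c] to [f x0 y0]. *)
  set (eps := Rmin (f x0 y0 - f x0 (y0 - eta)) (f x0 (y0 + eta) - f x0 y0) / 2).
  assert (eps0 : 0 < eps)
    by (unfold eps; apply Rdiv_lt_0_compat; [apply Rmin_glb_lt|]; lra).
  assert (epslo : 2 * eps <= f x0 y0 - f x0 (y0 - eta)).
  { unfold eps. pose proof (Rmin_l (f x0 y0 - f x0 (y0 - eta))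
      (f x0 (y0 + eta) - f x0 y0)). lra. }
  assert (epshi : 2 * eps <= f x0 (y0 + eta) - f x0 y0).
  { unfold eps. pose proof (Rmin_r (f x0 y0 - f x0 (y0 - eta))
      (f x0 (y0 + eta) - f x0 y0)). lra. }
  destruct (cf _ _ x00 ylo (mkposreal _ eps0)) as [d1 Hd1].
  destruct (cf _ _ x00 yhi (mkposreal _ eps0)) as [d2 Hd2].
  simpl in Hd1, Hd2.
  set (delta := Rmin a (Rmin d1 d2)).
  assert (delta0 : 0 < delta)
    by (unfold delta; repeat apply Rmin_glb_lt; auto; apply cond_pos).
  assert (deltaa : delta <= a) by apply Rmin_l.
  assert (delta1 : delta <= d1)
    by (eapply Rle_trans; [apply Rmin_r | apply Rmin_l]).
  assert (delta2 : delta <= d2)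
    by (eapply Rle_trans; [apply Rmin_r | apply Rmin_r]).
  set (Y := fun x c => epsilon (inhabits 0)
    (fun y => Rabs (y - y0) < eta /\ f x y = c)).
  assert (solve : forall x c, Rabs (x - x0) < delta ->
    Rabs (c - f x0 y0) < eps -> Rabs (Y x c - y0) < eta /\ f x (Y x c) = c).
  { intros x c Hx Hc.
    apply (epsilon_spec (inhabits 0) (fun y => Rabs (y - y0) < eta /\ f x y = c)).
    assert (xa : Rabs (x - x0) < a) by lra.
    assert (flo : f x (y0 - eta) < c).
    { assert (H : Rabs (f x (y0 - eta) - f x0 (y0 - eta)) < eps).
      { apply Hd1; [lra|]. rewrite Rminus_diag, Rabs_R0; apply cond_pos. }
      clear - H Hc epslo. abs_lra. }
    assert (fhi : c < f x (y0 + eta)).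
    { assert (H : Rabs (f x (y0 + eta) - f x0 (y0 + eta)) < eps).
      { apply Hd2; [lra|]. rewrite Rminus_diag, Rabs_R0; apply cond_pos. }
      clear - H Hc epshi. abs_lra. }
    destruct (IVT_Rbar_incr (fun y => f x y) (y0 - eta) (y0 + eta)
      (f x (y0 - eta)) (f x (y0 + eta)) c) as [y [Hy1 [Hy2 Hy]]].
    - apply (is_lim_continuity (fun y => f x y)), continuity_2d_pt_section_r; auto.
    - apply (is_lim_continuity (fun y => f x y)), continuity_2d_pt_section_r; auto.
    - simpl; intros y Hy1 Hy2. apply continuity_2d_pt_section_r, cf; auto.
      unfold eta in *; abs_lra.
    - simpl; unfold eta; lra.
    - simpl; auto.
    - simpl in Hy1, Hy2. exists y. split; auto. abs_lra. }
  assert (etaa : eta <= a) by (unfold eta; lra).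
  assert (cmp : forall x y1 y2, Rabs (x - x0) < delta -> Rabs (y1 - y0) < eta ->
    Rabs (y2 - y0) < eta -> f x y1 < f x y2 -> y1 < y2).
  { intros x y1 y2 Hx H1 H2 Hf.
    destruct (Rtotal_order y1 y2) as [H|[H|H]]; auto.
    - subst; lra.
    - assert (f x y2 < f x y1) by (apply incr; auto; lra). lra. }
  exists delta, eta, eps, Y. repeat split; auto.
  - unfold eta; lra.
  - now apply solve.
  - now apply solve.
  - destruct (solve x c) as [Hy fY]; auto. set (y := Y x c) in *.
    intros e.
    (* Both [y - r] and [y + r] must stay in the range where [f x] increases. *)
    set (r := Rmin e (eta - Rabs (y - y0)) / 2).
    assert (r0 : 0 < r).
    { unfold r. apply Rdiv_lt_0_compat; [|lra]. apply Rmin_glb_lt; [|lra].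
      apply cond_pos. }
    assert (re : r < e).
    { unfold r in *. pose proof (Rmin_l e (eta - Rabs (y - y0))). lra. }
    assert (reta : r < eta - Rabs (y - y0)).
    { unfold r in *. pose proof (Rmin_r e (eta - Rabs (y - y0))). lra. }
    assert (H1 : Rabs (y - r - y0) < eta).
    { pose proof (Rabs_triang (y - y0) (- r)) as T.
      rewrite Rabs_Ropp, (Rabs_right r) in T by lra.
      replace (y - r - y0) with (y - y0 + - r) by ring. lra. }
    assert (H2 : Rabs (y + r - y0) < eta).
    { pose proof (Rabs_triang (y - y0) r) as T.
      rewrite (Rabs_right r) in T by lra.
      replace (y + r - y0) with (y - y0 + r) by ring. lra. }
    assert (L1 : f x (y - r) < c) by (rewrite <- fY; apply incr; lra).
    assert (L2 : c < f x (y + r)) by (rewrite <- fY; apply incr; lra).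
    set (s := Rmin (c - f x (y - r)) (f x (y + r) - c) / 2).
    assert (s0 : 0 < s)
      by (unfold s; apply Rdiv_lt_0_compat; [apply Rmin_glb_lt|]; lra).
    assert (s1 : 2 * s <= c - f x (y - r)).
    { unfold s. pose proof (Rmin_l (c - f x (y - r)) (f x (y + r) - c)). lra. }
    assert (s2 : 2 * s <= f x (y + r) - c).
    { unfold s. pose proof (Rmin_r (c - f x (y - r)) (f x (y + r) - c)). lra. }
    destruct (cf x (y - r)) with (eps := mkposreal _ s0) as [e1 He1]; try lra.
    destruct (cf x (y + r)) with (eps := mkposreal _ s0) as [e2 He2]; try lra.
    simpl in He1, He2.
    set (d := Rmin (Rmin e1 e2) (Rmin s (Rmin (delta - Rabs (x - x0))
      (eps - Rabs (c - f x0 y0))))).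
    assert (d0 : 0 < d).
    { unfold d. repeat apply Rmin_glb_lt; try apply cond_pos; lra. }
    assert (de1 : d <= e1) by (unfold d, Rmin; repeat destruct Rle_dec; lra).
    assert (de2 : d <= e2) by (unfold d, Rmin; repeat destruct Rle_dec; lra).
    assert (ds : d <= s) by (unfold d, Rmin; repeat destruct Rle_dec; lra).
    assert (dd : d <= delta - Rabs (x - x0))
      by (unfold d, Rmin; repeat destruct Rle_dec; lra).
    assert (dc : d <= eps - Rabs (c - f x0 y0))
      by (unfold d, Rmin; repeat destruct Rle_dec; lra).
    exists (mkposreal _ d0); simpl; intros u v Hu Hv.
    assert (Hu0 : Rabs (u - x0) < delta).
    { replace (u - x0) with ((u - x) + (x - x0)) by ring.
      eapply Rle_lt_trans; [apply Rabs_triang|]; lra. }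
    assert (Hv0 : Rabs (v - f x0 y0) < eps).
    { replace (v - f x0 y0) with ((v - c) + (c - f x0 y0)) by ring.
      eapply Rle_lt_trans; [apply Rabs_triang|]; lra. }
    destruct (solve u v) as [Hyu fYu]; auto.
    assert (F1 : Rabs (f u (y - r) - f x (y - r)) < s).
    { apply He1; [lra|]. rewrite Rminus_diag, Rabs_R0; apply cond_pos. }
    assert (F2 : Rabs (f u (y + r) - f x (y + r)) < s).
    { apply He2; [lra|]. rewrite Rminus_diag, Rabs_R0; apply cond_pos. }
    assert (G1 : y - r < Y u v).
    { apply (cmp u); auto. rewrite fYu. clear - F1 Hv ds s1 s0. abs_lra. }
    assert (G2 : Y u v < y + r).
    { apply (cmp u); auto. rewrite fYu. clear - F2 Hv ds s2 s0. abs_lra. }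
    change (Rabs (Y u v - y) < e). apply Rabs_def1; lra.
  - intros x y Hx Hy Hf. destruct (solve x (f x y)) as [H1 H2]; auto.
    destruct (Rtotal_order (Y x (f x y)) y) as [H|[H|H]]; auto.
    + assert (f x (Y x (f x y)) < f x y) by (apply incr; auto; lra). lra.
    + assert (f x y < f x (Y x (f x y))) by (apply incr; auto; lra). lra.
Qed.

Lemma continuity_2d_pt_opp_arg (Y : R -> R -> R) (x c : R) :
  continuity_2d_pt Y x (- c) -> continuity_2d_pt (fun u v => Y u (- v)) x c.
Proof.
  intros cY e. destruct (cY e) as [d Hd]. exists d; intros u v Hu Hv.
  apply Hd; auto. rewrite <- Rabs_Ropp. now replace (- (- v - - c)) with (v - c) by ring.
Qed.

(** Reduces the case [dy f < 0] to the case [dy f > 0]. *)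
Lemma level_chart_opp (f : R -> R -> R) (x0 y0 delta eta eps : R)
    (Y : R -> R -> R) :
  level_chart (fun x y => - f x y) x0 y0 delta eta eps Y ->
  level_chart f x0 y0 delta eta eps (fun x c => Y x (- c)).
Proof.
  intros [H1 H2]. split.
  - intros x c Hx Hc. destruct (H1 x (- c)) as [A [B C]]; auto.
    + rewrite <- Rabs_Ropp. now replace (- (- c - - f x0 y0)) with (c - f x0 y0) by ring.
    + repeat split; auto; [lra|]. now apply continuity_2d_pt_opp_arg.
  - intros x y Hx Hy Hf. apply H2; auto.
    rewrite <- Rabs_Ropp. now replace (- (- f x y - - f x0 y0)) with (f x y - f x0 y0) by ring.
Qed.

Lemma increasing_of_dy_pos (D : R * R -> Prop) (f : R -> R -> R) (x0 y0 a : R) :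
  smooth_on D f ->
  (forall x y, Rabs (x - x0) < a -> Rabs (y - y0) < a ->
     D (x, y) /\ 0 < dy f x y) ->
  forall x y1 y2, Rabs (x - x0) < a -> Rabs (y1 - y0) < a ->
     Rabs (y2 - y0) < a -> y1 < y2 -> f x y1 < f x y2.
Proof.
  intros sf pos x y1 y2 Hx H1 H2 H.
  apply (incr_function_le (fun v => f x v) y1 y2 (dy f x)); simpl; try lra.
  - intros y A B. apply (smooth_on_is_derive_y D); auto.
    apply pos; auto. abs_lra.
  - intros y A B. apply pos; auto. abs_lra.
Qed.

Lemma level_chart_exists (D : R * R -> Prop) (f : R -> R -> R) (x0 y0 : R) :
  open D -> smooth_on D f -> D (x0, y0) -> dy f x0 y0 <> 0 ->
  exists delta eta eps Y, 0 < delta /\ 0 < eta /\ 0 < eps /\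
    (forall x y, Rabs (x - x0) < delta -> Rabs (y - y0) < eta -> D (x, y)) /\
    level_chart f x0 y0 delta eta eps Y.
Proof.
  assert (pos : forall f, open D -> smooth_on D f -> D (x0, y0) ->
    0 < dy f x0 y0 ->
    exists delta eta eps Y, 0 < delta /\ 0 < eta /\ 0 < eps /\
    (forall x y, Rabs (x - x0) < delta -> Rabs (y - y0) < eta -> D (x, y)) /\
    level_chart f x0 y0 delta eta eps Y).
  { clear f. intros f oD sf D0 fy.
    destruct (open_locally_2d D x0 y0 oD D0) as [d1 H1].
    destruct (smooth_on_continuity D (dy f) x0 y0 (smooth_on_dy _ _ sf) D0
      (mkposreal _ fy)) as [d2 H2]. simpl in H2.
    set (a := Rmin d1 d2).
    assert (a0 : 0 < a) by (apply Rmin_glb_lt; apply cond_pos).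
    assert (box : forall x y, Rabs (x - x0) < a -> Rabs (y - y0) < a ->
      D (x, y) /\ 0 < dy f x y).
    { intros x y Hx Hy. pose proof (Rmin_l d1 d2). pose proof (Rmin_r d1 d2).
      fold a in H, H0. split.
      - apply H1; lra.
      - assert (Rabs (dy f x y - dy f x0 y0) < dy f x0 y0) by (apply H2; lra).
        clear - H3. abs_lra. }
    destruct (level_chart_increasing f x0 y0 a) as (d & eta & eps & Y & A & B & C & L).
    - exact a0.
    - intros x y Hx Hy. apply (smooth_on_continuity D); auto. now apply box.
    - apply (increasing_of_dy_pos D); auto.
    - exists d, eta, eps, Y. repeat (split; [lra|]). split; auto.
      intros x y Hx Hy. apply box; lra. }
  intros oD sf D0 fy.
  destruct (Rlt_or_le 0 (dy f x0 y0)) as [H|H]; [auto|].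
  destruct (pos (fun x y => - f x y)) as (d & eta & eps & Y & A & B & C & E & L); auto.
  - now apply smooth_on_opp.
  - rewrite dy_opp. lra.
  - exists d, eta, eps, (fun x c => Y x (- c)). do 4 (split; [assumption|]).
    now apply level_chart_opp.
Qed.

(** * Level curves of a linear foliation *)

(** A path has to be continuous on all of [R]; clamping the parameter extends
    a path from [[0, 1]] by constants. *)
Definition clamp (t : R) : R := Rmax 0 (Rmin 1 t).

Lemma clamp_id (t : R) : 0 <= t <= 1 -> clamp t = t.
Proof. intros H. unfold clamp, Rmax, Rmin. repeat destruct Rle_dec; lra. Qed.

Lemma clamp_range (t : R) : 0 <= clamp t <= 1.
Proof. unfold clamp, Rmax, Rmin. repeat destruct Rle_dec; lra. Qed.

Lemma continuous_clamp (t : R) : continuous clamp t.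
Proof.
  apply filterlim_locally; intros e. exists e; intros s Hs.
  change (Rabs (clamp s - clamp t) < e). change (Rabs (s - t) < e) in Hs.
  apply Rabs_def2 in Hs. unfold clamp, Rmax, Rmin.
  pose proof (cond_pos e).
  apply Rabs_def1; repeat destruct Rle_dec; lra.
Qed.

Lemma joined_in_graph (A : R * R -> Prop) (h : R -> R) (x0 x1 : R) :
  (forall t, 0 <= t <= 1 ->
    continuity_pt h (x0 + t * (x1 - x0)) /\
    A (x0 + t * (x1 - x0), h (x0 + t * (x1 - x0)))) ->
  joined_in A (x0, h x0) (x1, h x1).
Proof.
  intros H.
  set (s := fun t => x0 + clamp t * (x1 - x0)).
  assert (cs : forall t, continuous s t).
  { intros t. unfold s. apply @continuous_plus; [apply continuous_const|].
    apply @continuous_mult; [apply continuous_clamp|apply continuous_const]. }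
  exists (fun t => (s t, h (s t))). repeat split.
  - intros t. apply (continuous_comp_2 s (fun t => h (s t)) (fun x y => (x, y))).
    + apply cs.
    + apply continuous_comp; [apply cs|].
      apply continuity_pt_filterlim. apply H, clamp_range.
    + apply (continuous_ext (fun z => z)); [now intros []|apply continuous_id].
  - intros t Ht. apply H, clamp_range.
  - unfold s. rewrite clamp_id by lra. now rewrite Rmult_0_l, Rplus_0_r.
  - unfold s. rewrite clamp_id by lra.
    now replace (x0 + 1 * (x1 - x0)) with x1 by ring.
Qed.

(** The graph of [Y(., c)] is connected, so it stays in the leaf through its
    point over [x0] and inherits the line containing that leaf. *)
Lemma level_curve_straight (D : R * R -> Prop) (f : R -> R -> R)
    (x0 y0 delta eta eps : R) (Y : R -> R -> R) (c : R) :
  0 < delta ->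
  linear_foliation D f ->
  (forall x y, Rabs (x - x0) < delta -> Rabs (y - y0) < eta -> D (x, y)) ->
  level_chart f x0 y0 delta eta eps Y ->
  Rabs (c - f x0 y0) < eps ->
  exists k m, forall x, Rabs (x - x0) < delta -> Y x c = k + m * x.
Proof.
  intros delta0 lin box [chart _] Hc.
  assert (x00 : Rabs (x0 - x0) < delta) by (rewrite Rminus_diag, Rabs_R0; auto).
  destruct (chart x0 c x00 Hc) as [Hy0 [fy0 _]].
  destruct (lin (x0, Y x0 c)) as [L [[a [b [k [ab HL]]]] leafL]].
  { now apply box. }
  assert (onL : forall x, Rabs (x - x0) < delta -> a * x + b * Y x c = k).
  { intros x Hx. apply (HL (x, Y x c)), leafL. unfold leaf; simpl.
    apply (joined_in_graph _ (fun x => Y x c)). intros t Ht.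
    assert (Hxt : Rabs (x0 + t * (x - x0) - x0) < delta).
    { replace (x0 + t * (x - x0) - x0) with (t * (x - x0)) by ring.
      rewrite Rabs_mult, (Rabs_right t) by lra.
      pose proof (Rabs_pos (x - x0)). nra. }
    destruct (chart _ c Hxt Hc) as [H1 [H2 H3]]. split.
    - now apply (continuity_2d_pt_section_l Y).
    - split; simpl; [now apply box | now rewrite H2, fy0]. }
  (* A vertical line cannot contain points over two distinct abscissas. *)
  destruct (Req_dec b 0) as [b0|b0].
  - assert (Hx : Rabs (x0 + delta / 2 - x0) < delta) by abs_lra.
    pose proof (onL _ x00) as E0. pose proof (onL _ Hx) as E1. subst b.
    assert (a * (delta / 2) = 0) by lra.
    destruct ab as [a0|b0]; [|lra].
    apply Rmult_integral in H. lra.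
  - exists (k / b), (- (a / b)). intros x Hx. rewrite <- (onL x Hx). now field.
Qed.

(** Along a level curve that is the line [y = k + m x], the derivative
    [dx f + m dy f] of [f] is zero. *)
Lemma slope_on_level_curve (D : R * R -> Prop) (f : R -> R -> R)
    (x0 y0 delta eta eps : R) (Y : R -> R -> R) (c k m x : R) :
  open D -> smooth_on D f ->
  (forall x y, Rabs (x - x0) < delta -> Rabs (y - y0) < eta -> D (x, y)) ->
  (forall x y, D (x, y) -> dy f x y <> 0) ->
  level_chart f x0 y0 delta eta eps Y ->
  Rabs (c - f x0 y0) < eps ->
  (forall x, Rabs (x - x0) < delta -> Y x c = k + m * x) ->
  Rabs (x - x0) < delta ->
  dx f x (Y x c) / dy f x (Y x c) = - m.
Proof.
  intros oD sf box fy [chart _] Hc line Hx.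
  destruct (chart x c Hx Hc) as [Hy _].
  assert (Dx : D (x, k + m * x)) by (rewrite <- line; auto).
  pose proof (is_derive_along_line D f k m x oD sf Dx) as E1.
  assert (E2 : is_derive (fun t => f t (k + m * t)) x 0).
  { apply (is_derive_ext_loc (fun _ => c)); [|apply @is_derive_const].
    refine (filter_imp _ _ _ (locally_abs_lt _ _ _ Hx)). intros t Ht.
    rewrite <- line; auto. symmetry. now apply chart. }
  apply is_derive_unique in E1. apply is_derive_unique in E2.
  rewrite line by auto. rewrite E1 in E2.
  apply Rmult_eq_reg_r with (dy f x (k + m * x)); auto.
  unfold Rdiv; rewrite Rmult_assoc, Rinv_l by auto. lra.
Qed.

(** * Smoothness of the gauge function *)

(** From [|r - l d| <= e' |d|], with [d] and [r] the increments of [h] and of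
    its argument, [e' <= |l| / 2] gives [|d| <= 2 |r| / |l|]; dividing the
    first bound by [|l|] then yields [|d - r / l| <= e |r|] as soon as
    [e' <= e |l|^2 / 2]. *)
Lemma is_derive_local_inverse (g h : R -> R) (c l : R) :
  is_derive g (h c) l -> l <> 0 -> continuity_pt h c ->
  locally c (fun s => g (h s) = s) ->
  is_derive h c (/ l).
Proof.
  intros dg l0 ch inv.
  pose proof (locally_singleton _ _ inv) as gc.
  split; [apply @is_linear_scal_l|].
  intros x Hx. apply (is_filter_lim_locally_unique (V := R_NormedModule)) in Hx. subst x.
  intros e.
  assert (al : 0 < Rabs l) by now apply Rabs_pos_lt.
  set (e' := Rmin (Rabs l / 2) (e * (Rabs l * Rabs l) / 2)).
  assert (e0 : 0 < e').
  { unfold e'. apply Rmin_glb_lt; [lra|]. pose proof (cond_pos e).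
    apply Rdiv_lt_0_compat; [|lra]. repeat apply Rmult_lt_0_compat; auto. }
  destruct dg as [_ dg].
  specialize (dg (h c) (fun P H => H) (mkposreal _ e0)).
  apply continuity_pt_filterlim in ch.
  specialize (ch _ dg). unfold filtermap in ch.
  refine (filter_imp _ _ _ (filter_and _ _ inv ch)).
  intros s [gs Hs].
  unfold norm, minus, plus, opp, scal in Hs |- *; simpl in Hs |- *.
  unfold abs, mult in Hs |- *; simpl in Hs |- *.
  rewrite gs, gc in Hs.
  set (d := h s + - h c) in *. set (r := s + - c) in *.
  assert (B1 : e' <= Rabs l / 2) by apply Rmin_l.
  assert (B2 : e' <= e * (Rabs l * Rabs l) / 2) by apply Rmin_r.
  assert (T : Rabs l * Rabs d <= Rabs r + e' * Rabs d).
  { rewrite <- Rabs_mult. replace (l * d) with (r + - (r + - (d * l))) by ring.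
    eapply Rle_trans; [apply Rabs_triang|]. rewrite Rabs_Ropp. lra. }
  pose proof (Rabs_pos d).
  assert (T2 : Rabs l * Rabs d <= 2 * Rabs r) by nra.
  apply Rmult_le_reg_l with (Rabs l * Rabs l); [nra|].
  rewrite <- Rabs_mult, <- Rabs_mult.
  replace (l * l * (d + - (r * / l))) with (l * - (r + - (d * l))) by (now field).
  rewrite (Rabs_mult l), Rabs_Ropp, Rabs_mult.
  apply Rle_trans with (Rabs l * (e' * Rabs d)); [nra|].
  apply Rle_trans with (e' * (2 * Rabs r)); [nra|].
  pose proof (Rabs_pos r). nra.
Qed.

(** The values [Y x0 c] invert [f x0], so [Y x0] has derivative [/ dy f] in
    [c].  The result has the shape of the function differentiated, with the
    smooth function [dy G / dy f] in place of [G]. *)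
Lemma is_derive_transversal (D : R * R -> Prop) (f G : R -> R -> R)
    (x0 y0 delta eta eps : R) (Y : R -> R -> R) (c : R) :
  0 < delta -> smooth_on D f -> smooth_on D G ->
  (forall x y, Rabs (x - x0) < delta -> Rabs (y - y0) < eta -> D (x, y)) ->
  (forall x y, D (x, y) -> dy f x y <> 0) ->
  level_chart f x0 y0 delta eta eps Y ->
  Rabs (c - f x0 y0) < eps ->
  is_derive (fun c => G x0 (Y x0 c)) c
    (dy G x0 (Y x0 c) / dy f x0 (Y x0 c)).
Proof.
  intros delta0 sf sG box fy [chart _] Hc.
  assert (x00 : Rabs (x0 - x0) < delta) by (rewrite Rminus_diag, Rabs_R0; auto).
  destruct (chart x0 c x00 Hc) as [Hy [_ cY]].
  replace (dy G x0 (Y x0 c) / dy f x0 (Y x0 c)) with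
    (scal (/ dy f x0 (Y x0 c)) (dy G x0 (Y x0 c)))
    by (unfold scal; simpl; unfold mult; simpl; unfold Rdiv; ring).
  apply (is_derive_comp (fun v => G x0 v) (fun c => Y x0 c)).
  - apply (smooth_on_is_derive_y D); auto.
  - apply (is_derive_local_inverse (fun v => f x0 v)); auto.
    + apply (smooth_on_is_derive_y D); auto.
    + now apply continuity_2d_pt_section_r.
    + refine (filter_imp _ _ _ (locally_abs_lt _ _ _ Hc)). intros s Hs. now apply chart.
Qed.

Lemma ex_derive_n_transversal (D : R * R -> Prop) (f G : R -> R -> R)
    (x0 y0 delta eta eps : R) (Y : R -> R -> R) (n : nat) (c : R) :
  open D -> 0 < delta -> smooth_on D f -> smooth_on D G ->
  (forall x y, Rabs (x - x0) < delta -> Rabs (y - y0) < eta -> D (x, y)) ->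
  (forall x y, D (x, y) -> dy f x y <> 0) ->
  level_chart f x0 y0 delta eta eps Y ->
  Rabs (c - f x0 y0) < eps ->
  ex_derive_n (fun c => G x0 (Y x0 c)) n c.
Proof.
  intros oD delta0 sf sG box fy chart.
  assert (iter : forall n, exists Gn, smooth_on D Gn /\
    forall c, Rabs (c - f x0 y0) < eps ->
      Derive_n (fun c => G x0 (Y x0 c)) n c = Gn x0 (Y x0 c)).
  { clear n c. induction n as [|n [Gn [sGn En]]].
    - now exists G.
    - exists (fun x y => dy Gn x y / dy f x y). split.
      + apply smooth_on_div; auto using smooth_on_dy.
      + intros c Hc. simpl.
        apply is_derive_unique.
        apply (is_derive_ext_loc (fun c => Gn x0 (Y x0 c))).
        * refine (filter_imp _ _ _ (locally_abs_lt _ _ _ Hc)).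
          intros s Hs. symmetry. now apply En.
        * now apply (is_derive_transversal D f Gn x0 y0 delta eta eps Y). }
  intros Hc. destruct n as [|n]; [exact I|].
  destruct (iter n) as [Gn [sGn En]].
  exists (dy Gn x0 (Y x0 c) / dy f x0 (Y x0 c)).
  apply (is_derive_ext_loc (fun c => Gn x0 (Y x0 c))).
  - refine (filter_imp _ _ _ (locally_abs_lt _ _ _ Hc)).
    intros s Hs. symmetry. now apply En.
  - now apply (is_derive_transversal D f Gn x0 y0 delta eta eps Y).
Qed.

(** * Euler's equation *)

(** With [w = F(f)], the left side is [F'(f) (dx f - w dy f)]. *)
Lemma function_of_euler (U : R * R -> Prop) (f w : R -> R -> R) :
  open U -> smooth_on U f ->
  (forall x y, U (x, y) -> dy f x y <> 0) ->
  (forall x y, U (x, y) -> w x y = dx f x y / dy f x y) ->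
  function_of U f w -> solves_euler U w.
Proof.
  intros oU sf fy wE [F HF] x y Uxy.
  destruct (HF x y Uxy) as [sF _].
  pose proof (open_locally_2d _ _ _ oU Uxy) as lU.
  pose proof (Derive_correct _ _ (sF 1%nat)) as dF. simpl in dF.
  set (F' := Derive F (f x y)) in *.
  assert (Ex : dx w x y = dx f x y * F').
  { apply is_derive_unique, (is_derive_ext_loc (fun u => F (f u y))).
    - refine (filter_imp _ _ _ (locally_2d_1d_const_y _ _ _ lU)). intros u Uu.
      symmetry. now apply HF.
    - apply (is_derive_comp F (fun u => f u y)); auto.
      now apply (smooth_on_is_derive_x U). }
  assert (Ey : dy w x y = dy f x y * F').
  { apply is_derive_unique, (is_derive_ext_loc (fun v => F (f x v))).
    - refine (filter_imp _ _ _ (locally_2d_1d_const_x _ _ _ lU)). intros u Uu.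
      symmetry. now apply HF.
    - apply (is_derive_comp F (fun v => f x v)); auto.
      now apply (smooth_on_is_derive_y U). }
  rewrite Ex, Ey, wE by auto. field. auto.
Qed.

Lemma leaf_slope_quotient (f : R -> R -> R) (x y : R) :
  leaf_slope f x y = - (dx f x y / dy f x y).
Proof. unfold leaf_slope, Rdiv. ring. Qed.

(** Where [w <> 0], Euler's equation [dx w = w dy w] makes the two partial
    derivatives vanish together, and [leaves_turn] excludes that. *)
Lemma euler_web_function (U : R * R -> Prop) (f w : R -> R -> R) :
  smooth_on U w -> solves_euler U w ->
  (forall x y, w x y = dx f x y / dy f x y) ->
  (forall x y, U (x, y) -> dx f x y <> 0 /\ dy f x y <> 0) ->
  web_function (fun q => U q /\ leaves_turn f q) w.
Proof.
  intros sw eul wE fne. split.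
  - intros x y [Uxy _]. now apply sw.
  - intros x y [Uxy turn].
    specialize (eul x y Uxy). destruct (fne x y Uxy) as [fx fy].
    assert (w0 : w x y <> 0).
    { rewrite wE. unfold Rdiv. apply Rmult_integral_contrapositive_currified; auto.
      now apply Rinv_neq_0_compat. }
    assert (Ex : dx (leaf_slope f) x y = - dx w x y).
    { unfold dx at 1. erewrite Derive_ext.
      - apply (Derive_opp (fun u => w u y)).
      - intros t. simpl. now rewrite leaf_slope_quotient, wE. }
    assert (Ey : dy (leaf_slope f) x y = - dy w x y).
    { unfold dy at 1. erewrite Derive_ext.
      - apply (Derive_opp (fun v => w x v)).
      - intros t. simpl. now rewrite leaf_slope_quotient, wE. }
    unfold leaves_turn in turn; simpl in turn. rewrite Ex, Ey in turn.
    assert (wy : dy w x y <> 0).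
    { intros wy. rewrite wy in *. destruct turn; lra. }
    split; auto. replace (dx w x y) with (w x y * dy w x y) by lra.
    now apply Rmult_integral_contrapositive_currified.
Qed.

Theorem theorem2p4 :
  forall (D : R * R -> Prop) (f : R -> R -> R),
    plane_domain D ->
    web_function D f ->
    linear_web D f ->
    forall p : R * R, D p ->
    exists (U : R * R -> Prop) (w : R -> R -> R),
      open U /\ U p /\ (forall q, U q -> D q) /\
      smooth_on U w /\
      function_of U f w /\
      solves_euler U w /\
      web_function (fun q => U q /\ leaves_turn f q) w.
Proof.
  intros D f [oD _] [sf fne] [_ [_ lin]] [x0 y0] D0.
  assert (fy : forall x y, D (x, y) -> dy f x y <> 0) by (intros; now apply fne).
  destruct (level_chart_exists D f x0 y0 oD sf D0 (fy _ _ D0))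
    as (delta & eta & eps & Y & delta0 & eta0 & eps0 & box & chart).
  set (w := fun x y => dx f x y / dy f x y).
  set (U := fun q : R * R => Rabs (fst q - x0) < delta /\
    Rabs (snd q - y0) < eta /\ Rabs (f (fst q) (snd q) - f x0 y0) < eps).
  assert (UD : forall q, U q -> D q) by (intros [x y] [Hx [Hy _]]; now apply box).
  assert (x00 : Rabs (x0 - x0) < delta) by (rewrite Rminus_diag, Rabs_R0; auto).
  assert (sw : smooth_on D w)
    by (apply smooth_on_div; auto using smooth_on_dx, smooth_on_dy).
  assert (oU : open U).
  { intros [x y] Uxy. pose proof (UD _ Uxy) as Dxy. destruct Uxy as [Hx [Hy Hf]].
    simpl in Hx, Hy, Hf.
    pose proof (proj1 (continuity_2d_pt_filterlim f x y)
      (smooth_on_continuity D f x y sf Dxy)) as cf.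
    repeat apply filter_and.
    - exact (continuous_fst x y _ (locally_abs_lt _ _ _ Hx)).
    - exact (continuous_snd x y _ (locally_abs_lt _ _ _ Hy)).
    - exact (cf _ (locally_abs_lt _ _ _ Hf)). }
  assert (swU : smooth_on U w) by (intros x y Uxy; apply sw; now apply UD).
  assert (fw : function_of U f w).
  { exists (fun c => w x0 (Y x0 c)). intros x y [Hx [Hy Hf]]. simpl in Hx, Hy, Hf.
    split.
    - intros n. now apply (ex_derive_n_transversal D f w x0 y0 delta eta eps Y).
    - destruct (level_curve_straight D f x0 y0 delta eta eps Y (f x y))
        as (k & m & line); auto.
      pose proof (fun t => slope_on_level_curve D f x0 y0 delta eta eps Y
        (f x y) k m t oD sf box fy chart Hf line) as slope.
      unfold w. rewrite (slope x0 x00), <- (slope x Hx).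
      now rewrite (proj2 chart x y Hx Hy Hf). }
  assert (eul : solves_euler U w).
  { apply (function_of_euler U f w); auto.
    intros x y Uxy; apply sf; now apply UD. }
  exists U, w. split; [exact oU|]. split.
  { now repeat split; simpl; rewrite Rminus_diag, Rabs_R0. }
  do 4 (split; [assumption|]). apply (euler_web_function U f w); auto.
Qed.
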